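(* Let $F(z)=\sum_{q=0}^{\infty}a_qz^q$ be holomorphic in a neighborhood of the origin with $a_0\neq 0$, and let $X\in\mathbb{C}$. Define the coefficients $c_p^{(X)}$ by $$\sum_{p=0}^{\infty}c_p^{(X)}z^p=F(z)^X .$$ Then for every integer $p\ge 0$ the following two expressions hold: (I) $$c_p^{(X)}=\sum_{0\le k_1,\dots,k_p\le p}\binom{X}{K}\frac{K!}{k_1!\cdots k_p!}\,\delta_{p,\sum_{m=1}^p mk_m}\;a_0^{X-K}a_1^{k_1}\cdots a_p^{k_p},\qquad K=k_1+\cdots+k_p ;$$ (II) $$c_p^{(X)}=\big(a_0^{X}\big)^{p+1}\,\det\!\big(M^{-X}+E\big),$$ where $M$ is the $(p+1)\times(p+1)$ lower-triangular Toeplitz matrix with entries $M_{ij}=a_{i-j}$ for $0\le j\le i\le p$ and $M_{ij}=0$ for $j>i$, and $E$ is the $(p+1)\times(p+1)$ matrix whose only nonzero column is its last column, equal to $(1,0,\dots,0,-1/a_0^X)^T$ (i.e. $e_0-a_0^{-X}e_p$).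
   Context: Powers with complex exponent: fix $\lambda\in\mathbb{C}$ with $e^\lambda=a_0$, set $a_0^{Y}=e^{Y\lambda}$ for $Y\in\mathbb{C}$ (so $a_0^{X-K}=a_0^Xa_0^{-K}$), and define $F(z)^X=\exp(X\log F(z))$ where $\log F$ is the holomorphic logarithm near $0$ with $\log F(0)=\lambda$. The generalized binomial coefficient is $\binom{X}{N}=X(X-1)\cdots(X-N+1)/N!$, and $\delta$ is the Kronecker delta. For a $(p+1)\times(p+1)$ lower-triangular Toeplitz matrix $M$ with diagonal entry $a_0\neq0$ and $Y\in\mathbb{C}$, $M^{Y}$ denotes $a_0^{Y}\sum_{n=0}^{p}\binom{Y}{n}(a_0^{-1}M-I)^n$ (a finite sum, since $a_0^{-1}M-I$ is nilpotent). For $p=0$ the sum in (I) is over the empty tuple and equals $a_0^X$. *)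

(* Defs.v *)
From mathcomp Require Import all_boot all_order all_algebra.
From mathcomp Require Import all_classical all_reals all_analysis.
From mathcomp Require Import complex.
Import Order.TTheory GRing.Theory Num.Theory.
Import numFieldNormedType.Exports numFieldTopology.Exports.

Set Implicit Arguments.
Unset Strict Implicit.
Unset Printing Implicit Defensive.

Local Open Scope ring_scope.

(* The complex numbers, seen as a numFieldType (hence normed, with the
   topology of the modulus). *)
Definition Cplx (R : realType) : numFieldType := R[i].

Definition cexp (R : realType) (z : Cplx R) : Cplx R :=
  limn (series (fun n => z ^+ n / n`!%:R)).

Definition gbinom (K : fieldType) (X : K) (N : nat) : K :=
  (\prod_(i < N) (X - i%:R)) / N`!%:R.

(* a_0^Y := e^{Y lambda}, for the fixed lambda with e^lambda = a_0. *)
Definition apow (R : realType) (lam Y : Cplx R) : Cplx R := cexp (Y * lam).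

Definition toeplitz (R : realType) (a : nat -> Cplx R) (p : nat) : 'M[Cplx R]_p.+1 :=
  \matrix_(i, j) if (j <= i)%N then a (i - j)%N else 0.

Definition tmxpow (R : realType) (lam a0 : Cplx R) (p : nat)
    (M : 'M[Cplx R]_p.+1) (Y : Cplx R) : 'M[Cplx R]_p.+1 :=
  apow lam Y *: \sum_(n < p.+1) gbinom Y n *: (a0^-1 *: M - 1%:M) ^+ n.

Definition Emx (R : realType) (lam X : Cplx R) (p : nat) : 'M[Cplx R]_p.+1 :=
  \matrix_(i, j) if j == ord_max
                 then (i == ord0)%:R - (i == ord_max)%:R * (apow lam X)^-1
                 else 0.

(* Main.v *)
(* Write F = a_0 (1 + u) near 0, with u(0) = 0.  Then w = L - lam tends to 0 at 0
   and exp(w) = 1 + u, so w(z) = O(z).  The formal identity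
   sum_n binom(X, n) (e^t - 1)^n = e^(X t) holds because the coefficient of each
   power of t is polynomial in X on both sides and the case of natural X is the
   binomial theorem.  Substituting t = w(z) and truncating, F^X = a_0^X V_X + O(z^(p+1))
   with V_X = sum_(n <= p) binom(X, n) U^n and U the polynomial of degree p that
   truncates u; no differentiation is needed.  As a polynomial that is O(z^(p+1)) has
   no coefficient of degree at most p, c_p = a_0^X [z^p] V_X and V_X V_(-X) = 1 modulo
   z^(p+1).  The multinomial theorem gives (I).  For (II), M is a polynomial in the
   nilpotent shift matrix J, so M^(-X) = a_0^(-X) V_(-X)(J) has inverse a_0^X V_X(J);
   multiplying M^(-X) + E by this inverse leaves a triangular matrix with diagonal
   1, ..., 1, c_p. *)

Require Import Defs.
From mathcomp Require Import all_boot all_order all_algebra.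
From mathcomp Require Import all_classical all_reals all_analysis.
From mathcomp Require Import complex.
Import Order.TTheory GRing.Theory Num.Theory.
Import numFieldNormedType.Exports numFieldTopology.Exports.
Local Open Scope classical_set_scope.
Local Open Scope ring_scope.

Set Implicit Arguments.
Unset Strict Implicit.
Unset Printing Implicit Defensive.

(** * Truncated polynomials and the shift matrix *)

Definition eqtrunc (A : nzRingType) (N : nat) (p q : {poly A}) : Prop :=
  forall i, (i < N)%N -> p`_i = q`_i.

Lemma eqtrunc_trans (A : nzRingType) N (p q r : {poly A}) :
  eqtrunc N p q -> eqtrunc N q r -> eqtrunc N p r.
Proof. by move=> pq qr i iN; rewrite pq ?qr. Qed.

Lemma eqtruncM (A : nzRingType) N (p p' q q' : {poly A}) :
  eqtrunc N p p' -> eqtrunc N q q' -> eqtrunc N (p * q) (p' * q').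
Proof.
move=> pp' qq' i iN; rewrite !coefM; apply: eq_bigr => j _.
rewrite pp' ?qq' //; first exact: leq_ltn_trans (leq_subr _ _) iN.
by rewrite (leq_ltn_trans _ iN) // -ltnS.
Qed.

Lemma coef_expr_lt (A : nzRingType) (p : {poly A}) n i :
  p`_0 = 0 -> (i < n)%N -> (p ^+ n)`_i = 0.
Proof.
move=> p0; elim: n i => // n IH i; rewrite ltnS => i_le; rewrite exprS coefM.
rewrite big_ord_recl p0 mul0r add0r big1 // => j _.
rewrite IH ?mulr0 // lift0; apply: leq_trans i_le.
by rewrite ltn_subrL (leq_ltn_trans _ (ltn_ord j)).
Qed.

(** The series exp(x t) cut below t^N, with t the polynomial variable: evaluated at z it
    approximates exp(x z), and at 1 it is a partial sum of exp(x). The ring is general because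
    [coef_binpow] takes x itself in a polynomial ring. *)
Definition texp (A : comUnitRingType) (N : nat) (x : A) : {poly A} :=
  \poly_(k < N) (x ^+ k / k`!%:R).

(** * Additivity of the truncated exponential and the multinomial theorem *)

Section TruncatedExponential.
Variable A : comUnitRingType.
Hypothesis fact_unit : forall n, n`!%:R \is a @GRing.unit A.

Lemma texp0 N : eqtrunc N (texp N (0 : A)) 1.
Proof.
move=> i iN; rewrite coef_poly iN coef1 expr0n.
by case: i {iN} => [|i]; rewrite ?mul0r // fact0 divr1.
Qed.

Lemma texpD N (x y : A) : eqtrunc N (texp N x * texp N y) (texp N (x + y)).
Proof.
move=> i iN; rewrite coefM coef_poly iN addrC exprDn mulr_suml.
apply: eq_bigr => j _; rewrite !coef_poly (leq_ltn_trans (leq_subr _ _) iN).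
have ji : (j <= i)%N by rewrite -ltnS.
rewrite (leq_ltn_trans ji iN).
apply: (mulIr (fact_unit i)); rewrite divrK // -{1}(bin_fact ji) !natrM.
by rewrite -[RHS]mulr_natr [X in _ * X]mulrC mulrA mulrACA !divrK // [x ^+ j * _]mulrC.
Qed.

Lemma texp_sum N (I : Type) (r : seq I) (x : I -> A) :
  eqtrunc N (\prod_(m <- r) texp N (x m)) (texp N (\sum_(m <- r) x m)).
Proof.
elim: r => [|m r IH]; first by rewrite !big_nil => i iN; rewrite texp0.
rewrite !big_cons; apply: eqtrunc_trans (texpD _ _).
exact: eqtruncM IH.
Qed.

(* The multinomial theorem, read off the coefficient of t^n in
   prod_m exp(x_m t) = exp((sum_m x_m) t). *)
Lemma multinomial p N (x : 'I_p -> A) n : (n < N)%N ->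
  (\sum_m x m) ^+ n =
  \sum_(k : {ffun 'I_p -> 'I_N} | n == (\sum_m k m)%N)
     n`!%:R / \prod_m (k m)`!%:R * \prod_m x m ^+ k m.
Proof.
move=> nN; have := @texp_sum N _ (index_enum 'I_p) x n nN.
rewrite [X in _ = X]coef_poly nN => E.
have -> : (\sum_m x m) ^+ n = n`!%:R * ((\sum_m x m) ^+ n / n`!%:R).
  by rewrite mulrC divrK.
rewrite -{}E.
rewrite (eq_bigr (fun m => \sum_(k < N) (x m ^+ k / k`!%:R) *: 'X^k)); last first.
  by move=> m _; rewrite /texp poly_def.
rewrite bigA_distr_bigA coef_sum mulr_sumr [RHS]big_mkcond /=.
apply: eq_bigr => k _.
have -> : \prod_m (x m ^+ k m / (k m)`!%:R *: 'X^(k m)) =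
   (\prod_m (x m ^+ k m / (k m)`!%:R)) *: 'X^((\sum_m k m)%N) :> {poly A}.
  rewrite scaler_prod; congr (_ *: _).
  by rewrite (big_morph _ (exprD 'X) (expr0 'X)).
rewrite coefZ coefXn; case: eqP => _; last by rewrite !mulr0.
by rewrite mulr1 big_split /= prodrV // mulrCA mulrC.
Qed.

End TruncatedExponential.

(** * The truncated binomial series *)

Lemma numField_fact_unit (K : numFieldType) n : n`!%:R \is a @GRing.unit K.
Proof. by rewrite unitfE pnatr_eq0 -lt0n fact_gt0. Qed.

Lemma poly_eq0_nat (K : numFieldType) (P : {poly K}) :
  (forall m : nat, P.[m%:R] = 0) -> P = 0.
Proof.
move=> P0; apply: (@roots_geq_poly_eq0 _ _ [seq m%:R | m <- iota 0 (size P)]).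
- by apply/allP => _ /mapP[m _ ->]; apply/rootP.
- by rewrite map_inj_uniq ?iota_uniq // => i j /eqP; rewrite eqr_nat => /eqP.
- by rewrite size_map size_iota.
Qed.

Lemma gbinom_nat (K : numFieldType) m n : gbinom (m%:R : K) n = 'C(m, n)%:R.
Proof.
apply: (canLR (mulrK (numField_fact_unit K n))).
rewrite -natrM bin_ffact; elim: n => [|n IH]; first by rewrite big_ord0 ffactn0.
(* For n > m the truncated difference m - n is not the one in the field, but the falling factorial
   is already 0. *)
rewrite big_ord_recr /= IH ffactnSr natrM; have [nm|mn] := leqP n m.
  by rewrite natrB.
by rewrite ffact_small ?mul0r.
Qed.

(* Both sides have coefficients polynomial in X, and agree for X natural. *)
Lemma gbinom_texp (K : numFieldType) N (X : K) :
  eqtrunc N (\sum_(n < N) gbinom X n *: (texp N 1 - 1) ^+ n) (texp N X).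
Proof.
set e := texp N 1 - 1; move=> i iN; apply/eqP; rewrite -subr_eq0.
(* [P] is the difference of the two coefficients of t^i, as a polynomial in X. *)
pose P : {poly K} := \sum_(n < N)
    ((e ^+ n)`_i / n`!%:R) *: \prod_(j < n) ('X - j%:R%:P) - i`!%:R^-1 *: 'X^i.
have PE Y : P.[Y] =
    (\sum_(n < N) gbinom Y n *: e ^+ n)`_i - (texp N Y)`_i.
  rewrite hornerD hornerN hornerZ hornerXn coef_poly iN [Y ^+ i / _]mulrC.
  congr (_ - _); rewrite horner_sum coef_sum; apply: eq_bigr => n _.
  rewrite hornerZ coefZ horner_prod /gbinom [LHS]mulrC -[RHS]mulrA.
  congr (_ * _); last by rewrite mulrC.
  by apply: eq_bigr => j _; rewrite hornerD hornerN hornerX hornerC.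
rewrite -PE; have -> : P = 0; last by rewrite horner0.
apply: poly_eq0_nat => m; rewrite PE; apply/eqP; rewrite subr_eq0; apply/eqP.
have N_gt0 : (0 < N)%N by apply: leq_ltn_trans iN.
have e0 : e`_0 = 0.
  by rewrite /e coefB coef_poly N_gt0 coef1 expr0 fact0 divr1 subrr.
have sumE : (\sum_(n < N) gbinom m%:R n *: e ^+ n)`_i = (texp N 1 ^+ m)`_i.
  have -> : texp N (1 : K) = e + 1 by rewrite subrK.
  (* The binomial theorem stops at n = m and the claim at n = N - 1; both sums extend to a common
     range, since binom(m, n) = 0 for n > m and e^n has no t^i for n >= N > i. *)
  have -> : (e + 1) ^+ m = \sum_(n < m.+1 + N) gbinom (m%:R : K) n *: e ^+ n.
    rewrite big_split_ord /= [X in _ = _ + X]big1 ?addr0; last first.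
      by move=> n _; rewrite gbinom_nat bin_small ?scale0r // addSn ltnS leq_addr.
    rewrite addrC exprDn; apply: eq_bigr => n _.
    by rewrite expr1n mul1r gbinom_nat scaler_nat.
  rewrite [(m.+1 + N)%N]addnC big_split_ord /= coefD.
  rewrite [X in _ = _ + X]coef_sum [X in _ = _ + X]big1 ?addr0 // => n _.
  by rewrite coefZ coef_expr_lt ?mulr0 // (leq_trans iN) ?leq_addr.
have mE : m%:R = \sum_(j < m) (1 : K) by rewrite sumr_const card_ord.
rewrite sumE mE -(texp_sum (numField_fact_unit K) _ _ iN).
by rewrite prodr_const card_ord.
Qed.

Lemma poly_fact_unit (K : numFieldType) n : n`!%:R \is a @GRing.unit {poly K}.
Proof.
by rewrite -(rmorph_nat (@polyC K)); apply: rmorph_unit; exact: numField_fact_unit.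
Qed.

(* The binomial series (1 + u)^X for u = sum_m x_m t^(m+1), accurate up to t^p. *)
Definition binpow (K : fieldType) (p : nat) (x : nat -> K) (X : K) : {poly K} :=
  \sum_(n < p.+1) gbinom X n *: (\sum_(m < p) x m *: 'X^(m.+1)) ^+ n.

(** The multinomial theorem is applied to the monomials x_m t^(m+1): the tuple k contributes in
    degree sum (m+1) k_m, which produces the Kronecker delta. *)
Lemma coef_binpow (K : numFieldType) p (x : nat -> K) (X : K) :
  (binpow p x X)`_p = \sum_(k : {ffun 'I_p -> 'I_p.+1})
    gbinom X (\sum_(m < p) (k m : nat))%N
    * ((\sum_(m < p) (k m : nat))`!%:R / \prod_(m < p) (k m)`!%:R)
    * (p == \sum_(m < p) (m.+1 * k m))%N%:R
    * \prod_(m < p) x m ^+ k m.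
Proof.
rewrite /binpow coef_sum.
under eq_bigr => n _ do rewrite coefZ (multinomial (@poly_fact_unit K) _ (ltn_ord n))
   coef_sum mulr_sumr big_mkcond /=.
rewrite exchange_big /=; apply: eq_bigr => k _; rewrite -big_mkcond /=.
set S := (\sum_(m < p) (k m : nat))%N; set W := (\sum_(m < p) m.+1 * k m)%N.
have termE n : (n`!%:R / \prod_m (k m)`!%:R
      * \prod_(m < p) (x m *: 'X^(m.+1)) ^+ k m : {poly K})`_p =
    n`!%:R / \prod_(m < p) (k m)`!%:R * (p == W)%:R * \prod_(m < p) x m ^+ k m.
  have -> : \prod_(m < p) (x m *: 'X^(m.+1)) ^+ k m =
      (\prod_(m < p) x m ^+ k m) *: 'X^W :> {poly K}.
    rewrite /W (big_morph _ (exprD 'X) (expr0 'X)) -scaler_prod.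
    by apply: eq_bigr => m _; rewrite exprZn exprM.
  have -> : n`!%:R / \prod_m (k m)`!%:R =
      (n`!%:R / \prod_(m < p) (k m)`!%:R)%:P :> {poly K}.
    rewrite rmorphM /= rmorphV; last first.
      by apply: rpred_prod => m _; exact: numField_fact_unit.
    rewrite rmorph_nat rmorph_prod; congr (_ / _).
    by apply: eq_bigr => m _; rewrite rmorph_nat.
  by rewrite mul_polyC !coefZ coefXn -mulrA; congr (_ * _); rewrite mulrC.
(* Exchanging the sums leaves for each k the single exponent n = S, if S <= p. Otherwise W >= S > p,
   so the delta kills the term on the right. *)
have [Sp|pS] := ltnP S p.+1.
  rewrite (big_pred1 (Ordinal Sp)) /= ?termE ?mulrA //.
rewrite big1; last first.
  by move=> n /eqP nS; have := ltn_ord n; rewrite nS ltnNge pS.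
suff /negPf -> : p != W by rewrite mulr0 mul0r.
rewrite neq_ltn (leq_trans pS) //; apply: leq_sum => m _.
by rewrite leq_pmull.
Qed.

(** * Polynomials in the nilpotent shift matrix, and the bordered determinant *)

Section ShiftMatrix.
Variables (K : fieldType) (p : nat).

Definition shiftmx : 'M[K]_p.+1 := \matrix_(i, j) (i == j.+1 :> nat)%:R.

Lemma horner_shiftmx (q : {poly K}) i j :
  horner_mx shiftmx q i j = if (j <= i)%N then q`_(i - j) else 0.
Proof.
elim/poly_ind: q i j => [|q c IH] i j; first by rewrite rmorph0 mxE coef0 if_same.
rewrite rmorphD rmorphM /= horner_mx_X horner_mx_C !mxE.
(* Right multiplication by the shift moves column j+1 to column j and puts 0 in the last column. *)
have -> : \sum_k horner_mx shiftmx q i k * shiftmx k j =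
    if (j < i)%N then q`_(i - j).-1 else 0.
  have [jp|jp] := ltnP j p.
    rewrite (bigD1 (Ordinal (jp : j.+1 < p.+1)%N)) //= mxE eqxx mulr1 IH /=.
    rewrite -subnS big1 ?addr0 // => k /negPf kj; rewrite mxE.
    by move: kj; rewrite -val_eqE /= => ->; rewrite mulr0.
  rewrite big1; last first.
    move=> k _; rewrite mxE; case: eqP => [kj|]; last by rewrite mulr0.
    by have := ltn_ord k; rewrite kj ltnS ltnNge jp.
  by rewrite ltnNge (leq_trans _ jp) // -ltnS.
rewrite coefD coefMX coefC subn_eq0 -val_eqE /=.
by case: ltngtP; rewrite ?add0r.
Qed.

Lemma horner_shiftmx_eqtrunc (q r : {poly K}) :
  eqtrunc p.+1 q r -> horner_mx shiftmx q = horner_mx shiftmx r.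
Proof.
move=> qr; apply/matrixP => i j; rewrite !horner_shiftmx qr //.
exact: leq_ltn_trans (leq_subr _ _) (ltn_ord i).
Qed.

(* Multiplying by [al *: horner_mx shiftmx r], of determinant [al ^+ p.+1], turns
   the matrix into the identity with last column replaced by [(al * r`_i)_i]. *)
Lemma det_border (al : K) (q r : {poly K}) :
  al != 0 -> q`_0 = 1 -> r`_0 = 1 -> eqtrunc p.+1 (r * q) 1 ->
  al ^+ p.+1 * \det (al^-1 *: horner_mx shiftmx q +
     \matrix_(i, j) if j == ord_max
                 then (i == ord0)%:R - (i == ord_max)%:R * al^-1
                 else 0) = al * r`_p.
Proof.
move=> al0 q0 r0 rq; set E := \matrix_(i, j) _.
have detr : \det (horner_mx shiftmx r) = 1.
  rewrite det_trig; last first.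
    by apply/is_trig_mxP => i j ij; rewrite horner_shiftmx leqNgt ij.
  by apply: big1 => i _; rewrite horner_shiftmx leqnn subnn.
rewrite -[al ^+ _]mulr1 -detr -detZ -det_mulmx.
rewrite mulmxDr -scalemxAl -!scalemxAr scalerA divff // scale1r.
rewrite mulmxE -rmorphM /= (horner_shiftmx_eqtrunc rq) rmorph1.
(* In the last column, the e_0 part of [E] gives al r_i, while the part along the last basis vector
   gives -1 on the diagonal and cancels the 1 of the identity. *)
have DE : 1 + al *: (horner_mx shiftmx r * E) = \matrix_(i, j)
    if j == ord_max then al * r`_i else (i == j)%:R.
  apply/matrixP => i j; rewrite !mxE; case: ifP => [/eqP ->|jm]; last first.
    by rewrite big1 ?mulr0 ?addr0 // => k _; rewrite [E _ _]mxE jm mulr0.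
  under eq_bigr => k _ do rewrite [E _ _]mxE eqxx mulrBr.
  rewrite sumrB (bigD1 ord0) //= mulr1 big1 ?addr0; last first.
    by move=> k /negPf ->; rewrite mulr0.
  rewrite (bigD1 ord_max) //= eqxx mul1r big1 ?addr0; last first.
    by move=> k /negPf ->; rewrite mul0r mulr0.
  rewrite !horner_shiftmx /= subn0 mulrBr mulrCA divff // mulr1.
  have [pi|ip] := leqP p i.
    have -> : i = ord_max by apply/val_inj/eqP; rewrite eqn_leq pi -ltnS ltn_ord.
    by rewrite eqxx subnn r0 addrC subrK.
  by rewrite -val_eqE /= (ltn_eqF ip) add0r subr0.
(* The matrix is upper triangular, and [det_trig] concerns lower triangular ones. *)
rewrite -scalerAl DE -det_tr det_trig; last first.
  apply/is_trig_mxP => i j ij; rewrite !mxE -!val_eqE /= (gtn_eqF ij).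
  by rewrite (ltn_eqF (leq_trans ij _)) // -ltnS.
rewrite big_ord_recr /= !mxE eqxx big1 ?mul1r // => i _; rewrite !mxE eqxx.
by rewrite -val_eqE /= ltn_eqF.
Qed.

End ShiftMatrix.

(** * Functions that are O(z^N) at the origin *)

Section Flat.
Variable K : numFieldType.
Implicit Types (f g w : K -> K) (P : {poly K}) (M N : nat).

(** The bound includes the point 0, and [flat 0] means bounded near 0. The constant lies in K
    because the norm takes its values there. *)
Definition flat N f : Prop :=
  exists2 C : K, 0 <= C & \forall z \near (0 : K), `|f z| <= C * `|z| ^+ N.

Lemma near0_norm_le (e : K) : 0 < e -> \forall z \near (0 : K), `|z| <= e.
Proof. by move=> e0; apply: nbhs0_le. Qed.

Lemma near0_norm_lt (e : K) : 0 < e -> \forall z \near (0 : K), `|z| < e.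
Proof. by move=> e0; apply: nbhs0_lt. Qed.

Lemma eq_flat N f g : (\forall z \near (0 : K), f z = g z) -> flat N f -> flat N g.
Proof.
move=> fg [C C0 fC]; exists C => //; near=> z.
have <- : f z = g z by near: z.
by near: z.
Unshelve. all: by end_near. Qed.

Lemma flatD N f g : flat N f -> flat N g -> flat N (fun z => f z + g z).
Proof.
move=> [C C0 fC] [D D0 gD]; exists (C + D); first exact: addr_ge0.
near=> z; rewrite mulrDl (le_trans (ler_normD _ _)) // lerD //.
- by near: z.
- by near: z.
Unshelve. all: by end_near. Qed.

Lemma flatM M N f g : flat M f -> flat N g -> flat (M + N) (fun z => f z * g z).
Proof.
move=> [C C0 fC] [D D0 gD]; exists (C * D); first exact: mulr_ge0.
near=> z; rewrite normrM exprD mulrACA ler_pM //; by near: z.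
Unshelve. all: by end_near. Qed.

Lemma flat_leq M N f : (M <= N)%N -> flat N f -> flat M f.
Proof.
move=> MN [C C0 fC]; exists C => //; near=> z.
apply: le_trans (_ : C * `|z| ^+ N <= _); first by near: z.
rewrite ler_wpM2l // ler_wiXn2l //; near: z; exact: near0_norm_le.
Unshelve. all: by end_near. Qed.

Lemma flat_cst (c : K) : flat 0 (fun=> c).
Proof. by exists `|c| => //; near=> z; rewrite expr0 mulr1.
Unshelve. all: by end_near. Qed.

Lemma flat0 N : flat N (fun=> 0).
Proof. by exists 0 => //; near=> z; rewrite normr0 mul0r.
Unshelve. all: by end_near. Qed.

Lemma flat_id : flat 1 id.
Proof. by exists 1 => //; near=> z; rewrite mul1r expr1.
Unshelve. all: by end_near. Qed.

Lemma flatZ N (c : K) f : flat N f -> flat N (fun z => c * f z).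
Proof. by move=> fN; apply: (@flatM 0); first exact: flat_cst. Qed.

Lemma flat_trans N f g h : flat N (fun z => f z - g z) ->
  flat N (fun z => g z - h z) -> flat N (fun z => f z - h z).
Proof.
move=> fg gh; apply: eq_flat (flatD fg gh); near=> z.
by rewrite addrA subrK.
Unshelve. all: by end_near. Qed.

Lemma flat_sum N (I : Type) (r : seq I) (F : I -> K -> K) :
  (forall i, flat N (F i)) -> flat N (fun z => \sum_(i <- r) F i z).
Proof.
move=> FN; elim: r => [|i r IH].
  by apply: eq_flat (flat0 N); near=> z; rewrite big_nil.
by apply: eq_flat (flatD (FN i) IH); near=> z; rewrite big_cons.
Unshelve. all: by end_near. Qed.

Lemma flat_horner P : flat 0 (horner P).
Proof.
elim/poly_ind: P => [|P c IH].
  by apply: eq_flat (flat0 0); near=> z; rewrite horner0.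
apply: eq_flat (flatD (flatM IH (flat_leq (leq0n 1) flat_id)) (flat_cst c)).
by near=> z; rewrite hornerMXaddC.
Unshelve. all: by end_near. Qed.

Lemma flat_eqtrunc0 N P : eqtrunc N P 0 -> flat N (horner P).
Proof.
move=> P0; have -> : P = drop_poly N P * 'X^N.
  rewrite -{1}(poly_take_drop N P) [take_poly _ _](_ : _ = 0) ?add0r //.
  by apply/polyP => i; rewrite coef_take_poly coef0; case: ifP => // /P0; rewrite coef0.
apply: eq_flat (_ : flat N (fun z => (drop_poly N P).[z] * z ^+ N)).
  by near=> z; rewrite hornerM hornerXn.
rewrite -[N in flat N _]add0n; apply: flatM; first exact: flat_horner.
by exists 1 => //; near=> z; rewrite mul1r normrX.
Unshelve. all: by end_near. Qed.

Lemma flat_eqtrunc N P Q : eqtrunc N P Q -> flat N (fun z => P.[z] - Q.[z]).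
Proof.
move=> PQ; apply: eq_flat (_ : flat N (horner (P - Q))).
  by near=> z; rewrite hornerD hornerN.
by apply: flat_eqtrunc0 => i iN; rewrite coefB coef0 PQ ?subrr.
Unshelve. all: by end_near. Qed.

Lemma flat1_cvg w : flat 1 w -> w z @[z --> (0 : K)] --> (0 : K).
Proof.
move=> [C C0 wC]; apply/(@cvgr0Pnorm_le _ _ _ _ (nbhs_filter (0 : K))) => e e0.
near=> z.
apply: le_trans (_ : C * `|z| ^+ 1 <= _); first by near: z.
rewrite expr1 (le_trans (_ : _ <= (C + 1) * `|z|)) //.
  by rewrite ler_wpM2r // lerDl.
rewrite -ler_pdivlMl ?ltr_wpDl //; near: z; apply: near0_norm_le.
by rewrite mulr_gt0 // invr_gt0 ltr_wpDl.
Unshelve. all: by end_near. Qed.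

Lemma flat_comp N f w : flat N f -> flat 1 w -> flat N (f \o w).
Proof.
move=> [C C0 fC] w1; have w0 := flat1_cvg w1; case: w1 => D D0 wD.
exists (C * D ^+ N); first by rewrite mulr_ge0 ?exprn_ge0.
have fwC : \forall z \near (0 : K), `|f (w z)| <= C * `|w z| ^+ N.
  exact: (w0 _ fC).
near=> z; apply: le_trans (_ : C * `|w z| ^+ N <= _); first by near: z.
rewrite -mulrA ler_wpM2l // -exprMn lerXn2r ?nnegrE ?mulr_ge0 //.
by rewrite -[`|z|]expr1; near: z.
Unshelve. all: by end_near. Qed.

Lemma flat0X f n : flat 0 f -> flat 0 (fun z => f z ^+ n).
Proof.
move=> f0; elim: n => [|n IH].
  by apply: eq_flat (flat_cst 1); near=> z; rewrite expr0.
by apply: eq_flat (flatM f0 IH); near=> z; rewrite exprS.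
Unshelve. all: by end_near. Qed.

Lemma flat_subX N f g n : flat 0 f -> flat 0 g ->
  flat N (fun z => f z - g z) -> flat N (fun z => f z ^+ n - g z ^+ n).
Proof.
move=> f0 g0 fg; elim: n => [|n IH].
  by apply: eq_flat (flat0 N); near=> z; rewrite subrr.
(* f^(n+1) - g^(n+1) = f (f^n - g^n) + g^n (f - g). *)
apply: eq_flat (flatD (flatM f0 IH) (flatM (flat0X n g0) fg)); near=> z.
by rewrite !exprS mulrBr [g z ^+ n * _]mulrC mulrBl addrA subrK.
Unshelve. all: by end_near. Qed.

(** If P_i is the first nonzero coefficient and i < N, then P = (P_i + z T) z^i; dividing by |z|^i
    gives |P_i| <= (C + D) |z|, which fails for small nonzero z. *)
Lemma flat_horner_eqtrunc0 N P : flat N (horner P) -> eqtrunc N P 0.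
Proof.
move=> PN i; elim/ltn_ind: i => i IH iN; rewrite coef0.
apply/eqP/negP => /negP Pi.
pose Q := drop_poly i P; pose T := drop_poly 1 Q.
have PE z : P.[z] = (P`_i + T.[z] * z) * z ^+ i.
  rewrite -{1}(poly_take_drop i P) [take_poly _ _](_ : _ = 0) ?add0r; last first.
    apply/polyP => j; rewrite coef_take_poly coef0; case: ifP => // ji.
    by rewrite IH ?coef0 // (ltn_trans ji).
  rewrite hornerM hornerXn -/Q -{1}(poly_take_drop 1 Q) -/T hornerD hornerM hornerX.
  congr ((_ + _) * _); rewrite [take_poly 1 _](_ : _ = (P`_i)%:P) ?hornerC //.
  apply/polyP => j; rewrite coef_take_poly coefC coef_drop_poly.
  by case: j.
have [C C0 PC] := PN; have [D D0 TD] := flat_horner T.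
have CD : 0 < C + D + 1 by rewrite ltr_wpDl ?addr_ge0.
(* Punctured neighbourhoods allow the division by |z|^i, and they are nonempty, so False cannot hold
   on one. *)
have : \forall z \near (0 : K)^', False.
  near=> z.
  have z0 : z != 0 by near: z; exact: nbhs_dnbhs_neq.
  have z_gt0 : 0 < `|z| by rewrite normr_gt0.
  have z1 : `|z| <= 1 by near: z; apply: nbhs_dnbhs; exact: near0_norm_le.
  have zC : `|P.[z]| <= C * `|z| ^+ N by near: z; apply: nbhs_dnbhs.
  have zD : `|T.[z]| <= D.
    rewrite -[D]mulr1 -(expr0 `|z|).
    by near: z; apply: nbhs_dnbhs.
  (* This radius makes (C + D) |z| at most |P_i| / 2; the 1 keeps the denominator positive. *)
  have zs : `|z| <= `|P`_i| / 2 / (C + D + 1).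
    by near: z; apply: nbhs_dnbhs; apply: near0_norm_le; rewrite !divr_gt0 ?normr_gt0.
  have le1 : `|P`_i + T.[z] * z| <= C * `|z|.
    move: zC; rewrite PE normrM normrX -{1}(subnK (ltnW iN)) exprD mulrA.
    rewrite ler_pM2r ?exprn_gt0 // => /le_trans; apply.
    by rewrite ler_wpM2l // -[leRHS]expr1 ler_wiXn2l // subn_gt0.
  have : `|P`_i| <= (C + D) * `|z|.
    rewrite -[P`_i](addrK (T.[z] * z)) (le_trans (ler_normB _ _)) // mulrDl lerD //.
    by rewrite normrM ler_wpM2r.
  rewrite ler_pdivlMr // mulrC in zs; move/le_trans => le2.
  have := le2 _ (le_trans (ler_wpM2r (ltW z_gt0) _) zs).
  rewrite lerDl ler_pdivlMr // mulr_natr mulr2n gerDl normr_le0 => /(_ ler01).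
  exact/negP.
by move=> /filter_ex[].
Unshelve. all: by end_near. Qed.

(** A Cauchy-type estimate: convergence at s = r/2 bounds |a_q| s^q by some M, so for |z| <= s/2 the
    tail from N on is at most (M / s^N) |z|^N times a geometric series of ratio 1/2. *)
Lemma flat_series (a : nat -> K) f (r : K) N : 0 < r ->
  (forall z : K, `|z| < r -> series (fun q => a q * z ^+ q) @ \oo --> f z) ->
  flat N (fun z => f z - \sum_(q < N) a q * z ^+ q).
Proof.
move=> r0 af; pose s := r / 2; have s0 : 0 < s by rewrite divr_gt0.
have sr : `|s| < r by rewrite gtr0_norm // ltr_pdivrMr // mulr_natr mulr2n ltrDl.
have [M M0 aM] : exists2 M, 0 <= M & forall q, `|a q| * s ^+ q <= M.
  have /cvg_seq_bounded : cvgn (series (fun q => a q * s ^+ q)).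
    by apply/cvg_ex; exists (f s); exact: af.
  move=> /pinfty_ex_gt0[B B0 SB]; exists (B + B); first by rewrite addr_ge0 ?ltW.
  move=> q; rewrite -[s in s ^+ q]gtr0_norm // -normrX -normrM.
  have -> : a q * s ^+ q = series (fun q => a q * s ^+ q) q.+1
     - series (fun q => a q * s ^+ q) q by rewrite seriesSB.
  by rewrite (le_trans (ler_normB _ _)) // lerD //; apply: SB.
exists (2 * M / s ^+ N); first by rewrite divr_ge0 ?mulr_ge0 ?exprn_ge0 // ltW.
near=> z.
have zs : `|z| <= s / 2.
  by near: z; apply: near0_norm_le; rewrite divr_gt0.
have zr : `|z| < r.
  apply: le_lt_trans sr; rewrite [leRHS]gtr0_norm //; exact: le_trans zs _.
(* The value f z is only known as a limit: a partial sum of n + N terms lies within e of it, and the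
   bound on its tail does not depend on n. *)
apply/ler_addgt0Pr => e e0.
have /cvgrPdist_le/(_ _ e0)[n _ /(_ (n + N)%N) fn] := af _ zr.
have {}fn := fn (leq_addr _ _).
rewrite -[f z](subrK (series (fun q => a q * z ^+ q) (n + N)%N)).
rewrite -addrA (le_trans (ler_normD _ _)) // [leRHS]addrC lerD //.
rewrite /series /= big_mkord [(n + N)%N]addnC big_split_ord /= addrAC subrr add0r.
apply: le_trans (ler_norm_sum _ _ _) _.
have tE (k : nat) : `|a (N + k)%N * z ^+ (N + k)| <=
    (M / s ^+ N * `|z| ^+ N) * 2^-1 ^+ k.
  rewrite normrM normrX exprD [leRHS]mulrAC mulrCA [leRHS]mulrC ler_wpM2l ?exprn_ge0 //.
  apply: le_trans (_ : `|a (N + k)%N| * (s / 2) ^+ k <= _).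
    by rewrite ler_wpM2l // lerXn2r // nnegrE // divr_ge0 // ltW.
  rewrite exprMn mulrA ler_wpM2r ?exprn_ge0 ?invr_ge0 // ler_pdivlMr ?exprn_gt0 //.
  by rewrite -mulrA -exprD addnC.
apply: le_trans; first by apply: ler_sum => k _; exact: tE.
rewrite -mulr_sumr.
have -> : \sum_(k < n) (2^-1 : K) ^+ k = 2 - 2 * 2^-1 ^+ n.
  elim: (n) => [|m IH]; first by rewrite big_ord0 mulr1 subrr.
  rewrite big_ord_recr /= IH exprS mulrA divff ?mul1r ?pnatr_eq0 //.
  by rewrite -addrA mulr_natl mulr2n opprD subrK.
rewrite -[2 * M / _]mulrA -[leRHS]mulrA [leRHS]mulrC ler_wpM2l //.
  by rewrite mulr_ge0 ?divr_ge0 ?exprn_ge0 // ltW.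
by rewrite gerBl mulr_ge0 ?exprn_ge0 ?invr_ge0.
Unshelve. all: by end_near. Qed.

End Flat.

(** * The complex exponential *)

Lemma horner_texp (A : comUnitRingType) N (x y : A) :
  (texp N x).[y] = \sum_(k < N) (x * y) ^+ k / k`!%:R.
Proof.
rewrite horner_poly; apply: eq_bigr => k _.
by rewrite exprMn mulrAC.
Qed.

(** The product and the truncated exponential of the sum agree below degree N, so the difference
    consists of terms x^j y^k / (j! k!) with j, k < N <= j + k. Their coefficients are positive, and
    the triangle inequality applies termwise. *)
Lemma norm_texpD_le (K : numFieldType) N (x y : K) :
  `|(texp N x).[1] * (texp N y).[1] - (texp N (x + y)).[1]| <=
  (texp N `|x|).[1] * (texp N `|y|).[1] - (texp N (`|x| + `|y|)).[1].
Proof.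
have diffE (u v : K) : (texp N u).[1] * (texp N v).[1] - (texp N (u + v)).[1] =
    \sum_(i < N) (texp N u * texp N v)`_(N + i).
  rewrite -hornerM (@horner_coef_wide _ (N + N)).
    rewrite big_split_ord /= [X in _ - X](@horner_coef_wide _ N) ?size_poly //.
    rewrite addrAC [X in X - _](_ : _ = \sum_(i < N) (texp N (u + v))`_i * 1 ^+ i).
      rewrite subrr add0r; apply: eq_bigr => i _.
      by rewrite expr1n mulr1.
    apply: eq_bigr => i _; congr (_ * _).
    by apply: texpD => // n; exact: numField_fact_unit.
  apply: leq_trans (size_polyMleq _ _) _.
  by rewrite (leq_trans (leq_pred _)) // leq_add ?size_poly.
rewrite !diffE (le_trans (ler_norm_sum _ _ _)) //; apply: ler_sum => i _.
rewrite !coefM (le_trans (ler_norm_sum _ _ _)) //; apply: ler_sum => j _.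
rewrite !coef_poly; case: ifP => _; case: ifP => _;
  rewrite ?mul0r ?mulr0 ?normr0 //.
by rewrite !normrM !normfV !normrX !normr_nat.
Qed.

(** The defect is dominated by the same defect for |x| and |y|, which tends to 0 by the functional
    equation of the real exponential; [phi] carries real bounds into K. *)
Lemma texpD_cvg0 (R : realType) (K : numFieldType) (phi : {rmorphism R -> K})
    (x y : K) (r s : R) : phi r = `|x| -> phi s = `|y| ->
  {homo phi : u v / u <= v} ->
  (forall e : K, 0 < e -> exists2 d : R, 0 < d & phi d <= e) ->
  (fun n => (texp n x).[1] * (texp n y).[1] - (texp n (x + y)).[1]) @ \oo --> (0 : K).
Proof.
move=> xr ys phi_homo phi_small.
have expE u n : (texp n (phi u)).[1] = phi (series (exp_coeff u) n).
  rewrite horner_texp /series /= big_mkord rmorph_sum.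
  apply: eq_bigr => k _.
  by rewrite rmorphM fmorphV rmorphXn rmorph_nat /= !mulr1.
have cr : (fun n => series (exp_coeff r) n * series (exp_coeff s) n
   - series (exp_coeff (r + s)) n) @ \oo --> (0 : R).
  rewrite [0](_ : _ = expR r * expR s - expR (r + s)); last by rewrite expRD subrr.
  apply: cvgB; last exact: is_cvg_series_exp_coeff.
  by apply: cvgM; exact: is_cvg_series_exp_coeff.
move/cvgr0Pnorm_le in cr.
apply/cvgr0Pnorm_le => e /phi_small[d d0 de].
have := cr _ d0; apply: filterS => n nd.
apply: le_trans de; apply: le_trans (norm_texpD_le _ _ _) _.
rewrite -xr -ys -rmorphD !expE -rmorphM -rmorphB; apply: phi_homo.
exact: le_trans (ler_norm _) nd.
Qed.

Section ComplexExponential.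
Variable R : realType.
Implicit Types (x y z : Cplx R).

(* The norm of [Cplx R] takes its values in [Cplx R]. *)
Definition modulus z : R := complex.Re (`|z| : R[i]).

Lemma modulusE z : (real_complex R (modulus z) : Cplx R) = `|z|.
Proof. by rewrite /modulus; apply: RRe_real; exact: normr_real. Qed.

Lemma normr_realcomplex (r : R) : `|real_complex R r : Cplx R| = real_complex R `|r|.
Proof. by rewrite normc_def /= expr0n addr0 sqrtr_sqr. Qed.

Lemma gt0_realcomplex (e : Cplx R) :
  0 < e -> exists2 r : R, 0 < r & e = real_complex R r.
Proof.
move=> e0; have er : real_complex R (complex.Re e) = e by apply/RRe_real/gtr0_real.
by exists (complex.Re e); [rewrite -ltcR er | rewrite er].
Qed.

Lemma cvg_real_complex (u : nat -> R) (l : R) :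
  u @ \oo --> l ->
  (fun n => real_complex R (u n) : Cplx R) @ \oo --> (real_complex R l : Cplx R).
Proof.
move=> /cvgrPdist_le ul; apply/cvgrPdist_le => e /gt0_realcomplex[r r0 ->].
have := ul _ r0; apply: filterS => n.
by rewrite -rmorphB normr_realcomplex lecR.
Qed.

Lemma normRe_le (z : Cplx R) : `|complex.Re z| <= modulus z.
Proof.
rewrite -lecR modulusE normc_def lecR -sqrtr_sqr ler_wsqrtr //.
by rewrite lerDl sqr_ge0.
Qed.

Lemma normIm_le (z : Cplx R) : `|complex.Im z| <= modulus z.
Proof.
rewrite -lecR modulusE normc_def lecR -sqrtr_sqr ler_wsqrtr //.
by rewrite lerDr sqr_ge0.
Qed.

Lemma seriesE_texp (K : numFieldType) (z : K) n :
  series (fun n => z ^+ n / n`!%:R) n = (texp n z).[1].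
Proof.
by rewrite /series /= big_mkord horner_texp; apply: eq_bigr => k _; rewrite mulr1.
Qed.

Lemma is_cvg_cexp (z : Cplx R) : cvgn (series (fun n => z ^+ n / n`!%:R)).
Proof.
pose t n : Cplx R := z ^+ n / n`!%:R.
have tn n : modulus (t n) = modulus z ^+ n / n`!%:R.
  apply: (@complexI R); rewrite modulusE normrM normfV normrX normr_nat.
  by rewrite rmorphM fmorphV rmorphXn rmorph_nat /= modulusE.
have cvgS (u : nat -> R) : (forall n, `|u n| <= modulus (t n)) -> cvgn (series u).
  move=> ut; apply: normed_cvg; apply: (series_le_cvg _ _ ut) => // [n|].
    by rewrite -ler0c modulusE.
  rewrite (_ : (fun n => modulus (t n)) = exp_coeff (modulus z)).
    exact: is_cvg_series_exp_coeff.
  by apply/funext => n; rewrite tn.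
(* Real and imaginary parts converge absolutely, being dominated by the exponential series of the
   modulus, and are then recombined. *)
have /cvg_ex[a ca] := cvgS _ (fun n => normRe_le (t n)).
have /cvg_ex[b cb] := cvgS _ (fun n => normIm_le (t n)).
apply/cvg_ex; exists ((real_complex R a : Cplx R) + ('i%C : Cplx R) * real_complex R b).
have -> : series t = (fun n =>
   (real_complex R (series (fun n => complex.Re (t n)) n) : Cplx R)
   + ('i%C : Cplx R) * real_complex R (series (fun n => complex.Im (t n)) n)).
  apply/funext => n; rewrite /series /= !rmorph_sum mulr_sumr -big_split /=.
  by apply: eq_bigr => k _; rewrite -complexE.
apply: cvgD; first exact: cvg_real_complex.
apply: cvgM; first exact: cvg_cst.
exact: cvg_real_complex.
Qed.

Lemma cvg_cexp (z : Cplx R) : (fun n => (texp n z).[1]) @ \oo --> cexp z.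
Proof.
rewrite (_ : (fun n => _) = series (fun n => z ^+ n / n`!%:R)).
  exact: is_cvg_cexp.
by apply/funext => n; rewrite seriesE_texp.
Qed.

Lemma cexpD x y : cexp (x + y) = cexp x * cexp y.
Proof.
apply/esym/eqP; rewrite -subr_eq0; apply/eqP.
have h1 : (fun n => (texp n x).[1] * (texp n y).[1] - (texp n (x + y)).[1]) @ \oo
    --> cexp x * cexp y - cexp (x + y).
  by apply: cvgB (@cvg_cexp _); apply: cvgM; exact: cvg_cexp.
apply: (cvg_unique (@norm_hausdorff _ (Cplx R)) h1).
apply: (@texpD_cvg0 R (Cplx R) (real_complex R) _ _ _ _ (modulusE x) (modulusE y)).
  by move=> u v uv; rewrite lecR.
by move=> e /gt0_realcomplex[r r0 ->]; exists r.
Qed.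

Lemma cexp0 : cexp (0 : Cplx R) = 1.
Proof.
apply: cvg_lim; first exact: norm_hausdorff.
apply: cvg_near_cst; near=> n; rewrite seriesE_texp horner_texp.
have : (0 < n)%N by near: n; exact: nbhs_infty_gt.
case: (n) => // m _.
rewrite big_ord_recl mul0r expr0 fact0 divr1 big1 ?addr0 // => i _.
by rewrite expr0n mul0r.
Unshelve. all: by end_near. Qed.

Lemma cexpN_mul z : cexp z * cexp (- z) = 1.
Proof. by rewrite -cexpD subrr cexp0. Qed.

Lemma cexp_neq0 z : cexp z != 0.
Proof.
by apply/eqP => z0; have /eqP := cexpN_mul z; rewrite z0 mul0r eq_sym oner_eq0.
Qed.

Lemma cexpN z : cexp (- z) = (cexp z)^-1.
Proof. by apply: (mulfI (cexp_neq0 z)); rewrite cexpN_mul divff ?cexp_neq0. Qed.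

Lemma cexpMn z n : cexp (n%:R * z) = cexp z ^+ n.
Proof.
elim: n => [|n IH]; first by rewrite mul0r cexp0.
by rewrite exprS -IH -cexpD -nat1r mulrDl mul1r.
Qed.

Lemma flat_cexp N X : flat N (fun z => cexp (X * z) - (texp N X).[z]).
Proof.
apply: eq_flat (_ : flat N ((fun v : Cplx R => cexp v -
   \sum_(q < N) (q`!%:R)^-1 * v ^+ q) \o (fun z => X * z))).
  near=> z; rewrite /= horner_texp; congr (_ - _).
  by apply: eq_bigr => k _; rewrite mulrC.
apply: flat_comp (flatZ _ (@flat_id _)).
(* The exponential series converges everywhere; 1 is an arbitrary radius. *)
apply: (@flat_series _ (fun q => (q`!%:R)^-1) _ 1) => // z _.
rewrite (_ : (fun q => _) = (fun n => z ^+ n / n`!%:R)).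
  exact: is_cvg_cexp.
by apply/funext => n; rewrite mulrC.
Unshelve. all: by end_near. Qed.

End ComplexExponential.

(** * Complex powers of a power series *)

Lemma near_comp0 (K : numFieldType) (w : K -> K) (P : K -> Prop) :
  w z @[z --> (0 : K)] --> (0 : K) ->
  (\forall v \near (0 : K), P v) -> \forall z \near (0 : K), P (w z).
Proof. by move=> w0 P0; exact: (w0 _ P0). Qed.

Section PowerOfExponential.
Variables (K : numFieldType) (expC : K -> K).
(** An abstract exponential, entering through its Taylor estimates at 0 and, further on, its
    additivity; it becomes [cexp] in the theorem. *)
Hypothesis expC_flat : forall N X, flat N (fun z => expC (X * z) - (texp N X).[z]).

(* Since e^v - 1 = v + O(v^2), near 0 we have |v| <= 2 |e^v - 1|. *)
Lemma flat_log (w : K -> K) :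
  w z @[z --> (0 : K)] --> (0 : K) ->
  flat 1 (fun z => expC (w z) - 1) -> flat 1 w.
Proof.
move=> w0 [D D0 wD]; have [C C0 eC] := expC_flat 2 (1 : K).
exists (D * 2); first by rewrite mulr_ge0.
have near_le : \forall v \near (0 : K), `|v| <= `|expC v - 1| * 2.
  near=> v.
  (* Chosen so that the remainder C |v|^2 is at most |v| / 2 and can be absorbed on the left. *)
  have vC : `|v| <= 2^-1 / (C + 1).
    by near: v; apply: near0_norm_le; rewrite divr_gt0 ?invr_gt0 // ltr_wpDl.
  have : `|expC (1 * v) - (texp 2 1).[v]| <= C * `|v| ^+ 2 by near: v.
  rewrite horner_texp !big_ord_recr big_ord0 /= add0r !mul1r fact0 invr1 mulr1 => ev.
  rewrite -ler_pdivrMr // -(lerD2r (`|v| / 2)).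
  rewrite -splitr.
  rewrite -[in leLHS](subKr (expC v - 1) v) (le_trans (ler_normB _ _)) // lerD //.
  rewrite -addrA -opprD -[v in X in `|_ - X|]expr1 (le_trans ev) //.
  rewrite expr2 mulrCA ler_wpM2l //.
  rewrite ler_pdivlMr ?ltr_wpDl // mulrC in vC.
  by apply: le_trans vC; rewrite ler_wpM2r // lerDl.
have wle : \forall z \near (0 : K), `|w z| <= `|expC (w z) - 1| * 2.
  exact: (near_comp0 (P := fun v => `|v| <= `|expC v - 1| * 2) w0 near_le).
near=> z; apply: le_trans (_ : `|expC (w z) - 1| * 2 <= _); first by near: z.
by rewrite mulrAC ler_wpM2r //; near: z.
Unshelve. all: by end_near. Qed.

Lemma flat_exp_binpow (p : nat) (x : nat -> K) (w u : K -> K) (X : K) :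
  w z @[z --> (0 : K)] --> (0 : K) ->
  (\forall z \near (0 : K), expC (w z) = 1 + u z) ->
  flat p.+1 (fun z => u z - (\sum_(m < p) x m *: 'X^(m.+1)).[z]) ->
  flat p.+1 (fun z => expC (X * w z) - (binpow p x X).[z]).
Proof.
move=> w0 wu uU; set U := \sum_(m < p) _ in uU.
have U1 : flat 1 (horner U).
  apply: flat_eqtrunc0 => -[|//] _; rewrite coef0 coef_sum big1 // => m _.
  by rewrite coefZ coefXn mulr0.
have u1 : flat 1 u.
  apply: eq_flat (flatD (flat_leq (ltn0Sn p) uU) U1).
  by near=> z; rewrite subrK.
have eu1 : flat 1 (fun z => expC (w z) - 1).
  apply: (@eq_flat _ 1 u _ _ u1); near=> z.
  have wz : expC (w z) = 1 + u z by near: z.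
  by rewrite wz addrC addKr.
have w1 : flat 1 w := flat_log w0 eu1.
pose e : {poly K} := texp p.+1 1 - 1.
have eu : flat p.+1 (fun z => e.[w z] - u z).
  apply: eq_flat (flatZ (-1) (flat_comp (expC_flat p.+1 1) w1)); near=> z.
  have wz : expC (w z) = 1 + u z by near: z.
  by rewrite /= mul1r wz mulN1r opprB /e hornerD hornerN hornerC opprD addrA.
have ew0 : flat 0 (fun z => e.[w z]) by apply: (flat_comp (flat_horner e)).
have h1 : flat p.+1 (fun z => expC (X * w z) - (texp p.+1 X).[w z]).
  exact: (flat_comp (expC_flat p.+1 X) w1).
have h2 : flat p.+1 (fun z => (texp p.+1 X).[w z] -
    (\sum_(n < p.+1) gbinom X n *: e ^+ n).[w z]).
  apply: (flat_comp (f := fun z => (texp p.+1 X).[z] - _.[z])) w1.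
  by apply: flat_eqtrunc => i ip; rewrite gbinom_texp.
(* The chain is e^(X w), its Taylor polynomial at w, the binomial sum in e(w), and finally the
   binomial sum in U, as e(w), u and U agree up to O(z^(p+1)). Since w = O(z), errors of order
   w^(p+1) are of order z^(p+1). *)
apply: flat_trans h1 _; apply: flat_trans h2 _.
apply: eq_flat (_ : flat p.+1 (fun z => \sum_(n < p.+1)
    gbinom X n * (e.[w z] ^+ n - U.[z] ^+ n))).
  near=> z; rewrite /binpow !horner_sum -sumrB; apply: eq_bigr => n _.
  by rewrite !hornerZ !horner_exp mulrBr /U horner_sum.
apply: flat_sum => n; apply: flatZ; apply: flat_subX => //.
- exact: flat_horner.
- exact: flat_trans eu uU.
Unshelve. all: by end_near. Qed.

Lemma flat_horner_eqtrunc N (P Q : {poly K}) :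
  flat N (fun z => P.[z] - Q.[z]) -> eqtrunc N P Q.
Proof.
move=> PQ i iN; apply/eqP; rewrite -subr_eq0 -coefB.
rewrite (@flat_horner_eqtrunc0 K N (P - Q)) ?coef0 //.
by apply: eq_flat PQ; near=> z; rewrite hornerD hornerN.
Unshelve. all: by end_near. Qed.

Hypothesis expCD : {morph expC : x y / x + y >-> x * y}.
Variables (F L : K -> K) (a : nat -> K) (lam r : K).
Hypotheses (a0_neq0 : a 0%N != 0) (exp_lam : expC lam = a 0%N) (r_gt0 : 0 < r).
Hypothesis F_series : forall z : K, `|z| < r ->
  series (fun q => a q * z ^+ q) @ \oo --> F z.
Hypothesis exp_L : forall z : K, `|z| < r -> expC (L z) = F z.
Hypothesis L_cvg : L z @[z --> (0 : K)] --> lam.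

Let x m := a m.+1 / a 0%N.

Lemma flat_exp_log p Y :
  flat p.+1 (fun z => expC (Y * (L z - lam)) - (binpow p x Y).[z]).
Proof.
apply: (flat_exp_binpow (u := fun z => F z / a 0%N - 1)).
- exact/(subr_cvg0 (FF := nbhs_filter (0 : K))).
- near=> z; have zr : `|z| < r by near: z; exact: near0_norm_lt.
  rewrite [RHS]addrC subrK -(exp_L zr) -[in RHS](subrK lam (L z)) [in RHS]expCD exp_lam.
  by rewrite mulfK.
- apply: eq_flat (flatZ (a 0%N)^-1 (flat_series p.+1 r_gt0 F_series)); near=> z.
  rewrite mulrBr mulrC -addrA; congr (_ + _).
  rewrite -opprD; congr (- _); rewrite big_ord_recl expr0 mulr1 mulrDr mulVf //.
  congr (_ + _); rewrite horner_sum mulr_sumr; apply: eq_bigr => m _.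
  by rewrite hornerZ hornerXn mulrA /x [_ / _]mulrC.
Unshelve. all: by end_near. Qed.

(** The truncated series of c and e^(X lam) V_X both approximate e^(X L) up to O(z^(p+1)), so their
    coefficients agree up to degree p. *)
Lemma coef_exp_series (c : nat -> K) (s X : K) p : 0 < s ->
  (forall z : K, `|z| < s ->
     series (fun q => c q * z ^+ q) @ \oo --> expC (X * L z)) ->
  c p = expC (X * lam) * (binpow p x X)`_p.
Proof.
move=> s0 cL.
have h : eqtrunc p.+1 (\poly_(q < p.+1) c q) (expC (X * lam) *: binpow p x X).
  apply: flat_horner_eqtrunc.
  apply: (@flat_trans _ _ _ (fun z => expC (X * L z))).
    apply: eq_flat (flatZ (-1) (flat_series p.+1 s0 cL)); near=> z.
    by rewrite mulN1r opprB horner_poly.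
  apply: eq_flat (flatZ (expC (X * lam)) (flat_exp_log p X)); near=> z.
  by rewrite mulrBr -expCD -mulrDr [lam + _]addrC subrK hornerZ.
by have := h p (ltnSn p); rewrite coef_poly ltnSn coefZ.
Unshelve. all: by end_near. Qed.

(** The two factors approximate e^(X w) and e^(-X w) with w = L - lam, whose product is 1. *)
Lemma binpowN p X : eqtrunc p.+1 (binpow p x X * binpow p x (- X)) 1.
Proof.
have exp0 : expC 0 = 1.
  have lam0 : expC lam != 0 by rewrite exp_lam.
  by apply: (mulIf lam0); rewrite -expCD add0r mul1r.
apply: flat_horner_eqtrunc.
set P := binpow p x X; set Q := binpow p x (- X).
have eP := flat_exp_log p X; have eQ := flat_exp_log p (- X).
have e0 : flat 0 (fun z => expC (- X * (L z - lam))).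
  apply: eq_flat (flatD (flat_leq (leq0n _) eQ) (flat_horner Q)).
  by near=> z; rewrite subrK.
(* P Q - 1 = -(e^(-X w) (e^(X w) - P) + P (e^(-X w) - Q)). *)
apply: eq_flat (flatZ (-1) (flatD (flatM e0 eP) (flatM (flat_horner P) eQ))).
near=> z; rewrite -/P -/Q hornerM hornerC mulN1r.
have : expC (- X * (L z - lam)) * expC (X * (L z - lam)) = 1.
  by rewrite -expCD -mulrDl addNr mul0r.
move: (expC _) (expC _) => E E' EE.
by rewrite !mulrBr EE [P.[z] * E']mulrC addrA subrK opprB.
Unshelve. all: by end_near. Qed.

End PowerOfExponential.

(** * Toeplitz powers and the two coefficient formulas *)

Lemma coef0_binpow (K : numFieldType) p (x : nat -> K) X : (binpow p x X)`_0 = 1.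
Proof.
rewrite /binpow big_ord_recl coefD expr0 coefZ coef1 /gbinom big_ord0 fact0 divr1.
rewrite mulr1 coef_sum big1 ?addr0 // => n _.
rewrite coefZ coef_expr_lt ?mulr0 // coef_sum big1 // => m _.
by rewrite coefZ coefXn mulr0.
Qed.

(** The matrix a_0^(-1) M - I is U evaluated at the shift, and evaluation is a ring morphism, so the
    sum defining the matrix power is V_Y at the shift. *)
Lemma tmxpowE (R : realType) (a : nat -> Cplx R) lam p Y : a 0%N != 0 ->
  tmxpow lam (a 0%N) (toeplitz a p) Y =
  apow lam Y *: horner_mx (shiftmx _ p) (binpow p (fun m => a m.+1 / a 0%N) Y).
Proof.
move=> a0; rewrite /tmxpow /binpow rmorph_sum; congr (_ *: _).
have -> : (a 0%N)^-1 *: toeplitz a p - 1%:M =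
    horner_mx (shiftmx _ p) (\sum_(m < p) (a m.+1 / a 0%N) *: 'X^(m.+1)).
  apply/matrixP => i j; rewrite horner_shiftmx !mxE.
  have [ji|ij] := leqP j i; last first.
    by rewrite -val_eqE /= (ltn_eqF ij) mulr0 subr0.
  rewrite coef_sum; have [->|ij] := eqVneq i j.
    rewrite subnn mulVf // subrr big1 // => m _.
    by rewrite coefZ coefXn mulr0.
  have ij' : (j < i)%N by rewrite ltn_neqAle ji eq_sym andbT.
  have kp : ((i - j).-1 < p)%N.
    by rewrite -ltnS prednK ?subn_gt0 // (leq_trans _ (ltn_ord i)) // ltnS leq_subr.
  rewrite (bigD1 (Ordinal kp)) //= coefZ coefXn prednK ?subn_gt0 // eqxx mulr1.
  rewrite big1 ?addr0 ?subr0 1?mulrC // => m /negPf mk.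
  rewrite coefZ coefXn; case: eqP => [im|]; last by rewrite mulr0.
  by move: mk; rewrite -val_eqE /= im eqxx.
apply: eq_bigr => n _; rewrite /= horner_mxZ; congr (_ *: _).
by rewrite rmorphXn.
Qed.

Theorem theorem1 (R : realType) (F L : Cplx R -> Cplx R) (a c : nat -> Cplx R)
    (lam X : Cplx R) :
  a 0%N != 0 ->
  cexp lam = a 0%N ->
  (exists2 r : Cplx R, 0 < r & forall z : Cplx R, `|z| < r ->
     [/\ series (fun q => a q * z ^+ q) @ \oo --> F z,
         derivable L z 1 &
         cexp (L z) = F z]) ->
  L 0 = lam ->
  (exists2 r : Cplx R, 0 < r & forall z : Cplx R, `|z| < r ->
     series (fun q => c q * z ^+ q) @ \oo --> cexp (X * L z)) ->
  forall p : nat,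
    c p = \sum_(k : {ffun 'I_p -> 'I_p.+1})
            gbinom X (\sum_(m < p) (k m : nat))%N
            * ((\sum_(m < p) (k m : nat))`!%:R / \prod_(m < p) (k m)`!%:R)
            * (p == \sum_(m < p) (m.+1 * k m))%N%:R
            * apow lam (X - (\sum_(m < p) (k m : nat))%N%:R)
            * \prod_(m < p) a m.+1 ^+ k m
    /\
    c p = apow lam X ^+ p.+1
          * \det (tmxpow lam (a 0%N) (toeplitz a p) (- X) + Emx lam X p).
Proof.
move=> a0 elam [r r0 FL] L0 [s s0 cL] p.
have F_series z zr := let: And3 h _ _ := FL z zr in h.
have exp_L z zr := let: And3 _ _ h := FL z zr in h.
have L_cvg : L z @[z --> (0 : Cplx R)] --> lam.
  rewrite -L0; have [|_ dL _] := FL 0; first by rewrite normr0.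
  by move: dL => /derivable1_diffP/differentiable_continuous.
have cE : c p = apow lam X * (binpow p (fun m => a m.+1 / a 0%N) X)`_p.
  exact: (coef_exp_series (@flat_cexp R) (@cexpD R) a0 elam r0 F_series exp_L L_cvg
    p s0 cL).
have VV := binpowN (@flat_cexp R) (@cexpD R) a0 elam r0 F_series exp_L L_cvg X.
split.
  rewrite cE coef_binpow mulr_sumr; apply: eq_bigr => k _.
  set S := (\sum_(m < p) (k m : nat))%N.
  (* The power a_0^(-S) collects the denominators of the normalized coefficients a_(m+1) / a_0. *)
  have -> : apow lam (X - S%:R) = apow lam X * (a 0%N ^+ S)^-1.
    by rewrite /apow mulrBl cexpD cexpN cexpMn elam.
  have -> : \prod_(m < p) (a m.+1 / a 0%N) ^+ k m =
      (\prod_(m < p) a m.+1 ^+ k m) * (a 0%N ^+ S)^-1.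
    rewrite -prodrXr -prodfV -big_split /=; apply: eq_bigr => m _.
    by rewrite exprMn exprVn.
  rewrite [LHS]mulrCA -[RHS]mulrA; congr (_ * _).
  by rewrite mulrA [RHS]mulrAC.
have apow0 : apow lam X != 0 by exact: cexp_neq0.
have apowN : apow lam (- X) = (apow lam X)^-1 by rewrite /apow mulNr cexpN.
rewrite cE tmxpowE // apowN; apply/esym.
(* Here q = V_(-X) and r = V_X, inverse to each other modulo z^(p+1). *)
exact: det_border apow0 (coef0_binpow _ _ _) (coef0_binpow _ _ _) (VV p).
Qed.
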